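(* Let $f:\mathbb{R}^n\to\mathbb{R}^n$ be $C^\infty$ with $f(0)=0$, such that $A=\frac{\partial f}{\partial x}(0)$ has no eigenvalue on the imaginary axis. Let $\{\phi_{\lambda_\ell}(x),\lambda_\ell\}$, $\ell=1,\dots,n$, be the principal (generalized) eigenfunction–eigenvalue pairs of the Koopman generator corresponding to the system $\dot x=f(x)$, where the $\phi_{\lambda_\ell}$ are $C^2$ functions on a domain $\mathcal{P}_x\subseteq\mathbb{R}^n$. Let $H_0(x,p)=p^\top f(x)$ and consider the Hamiltonian system $$\dot x=\frac{\partial H_0}{\partial p}=f(x),\qquad \dot p=-\frac{\partial H_0}{\partial x}=-\Big(\frac{\partial f}{\partial x}(x)\Big)^\top p.$$ Then $\{\phi_{\lambda_\ell}(x),\lambda_\ell\}$, $\ell=1,\dots,n$, and $\{H_0(x,p),0\}$ are principal (generalized) eigenfunction–eigenvalue pairs of the Koopman generator associated with this Hamiltonian system.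
   Context: For a system $\dot z=F(z)$ the Koopman generator acts on $C^1$ functions $\psi$ by $\mathcal{K}_F\psi=\frac{\partial\psi}{\partial z}F$. A $C^1$ function $\psi$ is an eigenfunction with eigenvalue $\lambda$ if $\frac{\partial\psi}{\partial z}F=\lambda\psi$. Functions $\psi^1,\dots,\psi^m$ are generalized eigenfunctions with eigenvalue $\lambda$ if $\frac{\partial\psi^1}{\partial z}F=\lambda\psi^1$ and $\frac{\partial\psi^k}{\partial z}F=\lambda\psi^k+\psi^{k-1}$ for $k=2,\dots,m$. The (generalized) eigenfunctions whose eigenvalues are eigenvalues of the linearization of $F$ at the equilibrium at the origin are called principal (generalized) eigenfunctions. Let $\lambda_1,\dots,\lambda_q$ ($q\le n$) be the distinct eigenvalues of $A$, with $\lambda_j$ of algebraic multiplicity $m_j$ and geometric multiplicity one (higher geometric multiplicity is treated by listing the eigenspaces separately), and let $\phi_{\lambda_j}^k$, $k=1,\dots,m_j$, be the principal (generalized) eigenfunctions associated with $\lambda_j$. The single-index list $\{\phi_{\lambda_\ell},\lambda_\ell\}_{\ell=1}^n$ enumerates all the pairs $\{\phi_{\lambda_j}^k,\lambda_j\}$. The domain $\mathcal{P}_x$ contains the origin, and all these functions are well defined on it. For the Hamiltonian system, $\phi_{\lambda_\ell}$ is regarded as the function $(x,p)\mapsto\phi_{\lambda_\ell}(x)$.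
   Formalization: The pair {H_0, 0} is shown to be an eigenfunction–eigenvalue pair but not a ''principal'' one: since A has no eigenvalue on the imaginary axis, 0 is never an eigenvalue of the linearization diag(A, -A^T), so that word is false for H_0 (e.g. n=1, f(x)=x). *)

(* Defs.v *)
From HB Require Import structures.
From mathcomp Require Import all_boot all_order all_algebra complex.
From mathcomp Require Import all_classical all_reals all_analysis.

Set Implicit Arguments.
Unset Strict Implicit.
Unset Printing Implicit Defensive.

Import Order.TTheory GRing.Theory Num.Theory.
Import numFieldNormedType.Exports.

Local Open Scope classical_set_scope.
Local Open Scope ring_scope.
Local Open Scope complex_scope.

Definition partial (R : realType) (N : nat) (i : 'I_N) (g : 'cV[R]_N -> R)
    (z : 'cV[R]_N) : R :=
  'D_(delta_mx i 0) g z.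

(* [D] is meant to be open: derivatives and limits are taken in the whole
   space, so only the values of [g] near the points of [D] matter. *)
Fixpoint Ck_on (R : realType) (N k : nat) (D : set 'cV[R]_N)
    (g : 'cV[R]_N -> R) : Prop :=
  (forall z, D z -> {for z, continuous g}) /\
  if k is k'.+1 then
    forall i : 'I_N, (forall z, D z -> derivable g z (delta_mx i 0)) /\
                     Ck_on k' D (partial i g)
  else True.

(* R[i] carries no normed R-module structure in the library, hence the real and
   imaginary parts. *)
Definition Ck_on_complex (R : realType) (N k : nat) (D : set 'cV[R]_N)
    (psi : 'cV[R]_N -> R[i]) : Prop :=
  Ck_on k D (fun z => complex.Re (psi z)) /\
  Ck_on k D (fun z => complex.Im (psi z)).

Definition smooth (R : realType) (N M : nat) (F : 'cV[R]_N -> 'cV[R]_M) : Prop :=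
  forall (k : nat) (i : 'I_M), Ck_on k setT (fun z => F z i 0).

Definition jacobian_mx (R : realType) (N M : nat) (F : 'cV[R]_N -> 'cV[R]_M)
    (z : 'cV[R]_N) : 'M[R]_(M, N) :=
  \matrix_(i, j) partial j (fun y => F y i 0) z.

Definition complex_mx (R : realType) (M N : nat) (A : 'M[R]_(M, N)) :
    'M[R[i]]_(M, N) :=
  map_mx (fun x : R => x%:C) A.

Definition hyperbolic (R : realType) (N : nat) (A : 'M[R]_N) : Prop :=
  forall l : R[i], eigenvalue (complex_mx A) l -> complex.Re l != 0.

(* d psi / dz, as a row vector *)
Definition complex_gradient (R : realType) (N : nat) (psi : 'cV[R]_N -> R[i])
    (z : 'cV[R]_N) : 'rV[R[i]]_N :=
  \row_i (partial i (fun y => complex.Re (psi y)) z +i*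
          partial i (fun y => complex.Im (psi y)) z).

Definition koopman (R : realType) (N : nat) (F : 'cV[R]_N -> 'cV[R]_N)
    (psi : 'cV[R]_N -> R[i]) (z : 'cV[R]_N) : R[i] :=
  (complex_gradient psi z *m complex_mx (F z)) 0 0.

Definition eigenfunction (R : realType) (N : nat) (F : 'cV[R]_N -> 'cV[R]_N)
    (D : set 'cV[R]_N) (l : R[i]) (psi : 'cV[R]_N -> R[i]) : Prop :=
  Ck_on_complex 1 D psi /\ forall z, D z -> koopman F psi z = l * psi z.

(* The chain psi^1, ..., psi^m is indexed from 0. *)
Definition gen_eigenfunctions (R : realType) (N : nat)
    (F : 'cV[R]_N -> 'cV[R]_N) (D : set 'cV[R]_N) (l : R[i]) (m : nat)
    (psi : 'I_m -> 'cV[R]_N -> R[i]) : Prop :=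
  [/\ forall k : 'I_m, Ck_on_complex 1 D (psi k),
      forall k : 'I_m, k = 0%N :> nat ->
        forall z, D z -> koopman F (psi k) z = l * psi k z
    & forall k k' : 'I_m, k' = k.+1 :> nat ->
        forall z, D z -> koopman F (psi k') z = l * psi k' z + psi k z].

Definition principal_gen_eigenfunctions (R : realType) (N : nat)
    (F : 'cV[R]_N -> 'cV[R]_N) (D : set 'cV[R]_N) (l : R[i]) (m : nat)
    (psi : 'I_m -> 'cV[R]_N -> R[i]) : Prop :=
  eigenvalue (complex_mx (jacobian_mx F 0)) l /\ gen_eigenfunctions F D l psi.

(* If [lam] is injective, this says that [lam] enumerates the distinct
   eigenvalues of [A], that each has geometric multiplicity one, and that [m]
   gives the algebraic multiplicities. Otherwise an eigenvalue is listed once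
   for each dimension of its eigenspace, and the chain lengths [m j] attached to
   it add up to its algebraic multiplicity. *)
Definition eigenvalue_listing (R : realType) (N : nat) (A : 'M[R]_N) (q : nat)
    (lam : 'I_q -> R[i]) (m : 'I_q -> nat) : Prop :=
  [/\ forall j, (0 < m j)%N,
      forall l : R[i],
        #|[set j | lam j == l]%SET| = \rank (eigenspace (complex_mx A) l)
    & forall l : R[i],
        (\sum_(j < q | lam j == l) m j)%N = mup l (char_poly (complex_mx A))].

(* A point of the phase space is col_mx x p, i.e. x = usubmx z, p = dsubmx z. *)
Definition hamiltonian_field (R : realType) (n : nat)
    (H : 'cV[R]_(n + n) -> R) (z : 'cV[R]_(n + n)) : 'cV[R]_(n + n) :=
  col_mx (\col_(i < n) partial (rshift n i) H z)
         (- \col_(i < n) partial (lshift n i) H z).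

(* The linearization at the origin of the Hamiltonian system of H0 is
   block_mx A 0 0 (- A^T), which is invertible when A is hyperbolic: the
   eigenvalue 0 of H0 is therefore not principal. *)
Definition H0 (R : realType) (n : nat) (f : 'cV[R]_n -> 'cV[R]_n)
    (z : 'cV[R]_(n + n)) : R :=
  ((dsubmx z)^T *m f (usubmx z)) 0 0.

(* Main.v *)
Require Import Defs.
From HB Require Import structures.
From mathcomp Require Import all_boot all_order all_algebra complex.
From mathcomp Require Import all_classical all_reals all_analysis.

Set Implicit Arguments.
Unset Strict Implicit.
Unset Printing Implicit Defensive.

Import Order.TTheory GRing.Theory Num.Theory.
Import numFieldNormedType.Exports.

Local Open Scope classical_set_scope.
Local Open Scope ring_scope.
Local Open Scope complex_scope.

(* The x-component of the Hamiltonian field is f, so the projection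
   (x, p) |-> x is a semiconjugacy onto xdot = f(x). Pulling back along it
   preserves the (generalized) eigenfunction equations, and the Jacobian at 0 is
   block lower triangular with upper left block A, so a left eigenvector v of A
   gives the left eigenvector (v, 0). For H0, the Koopman generator returns the
   Poisson bracket {H0, H0} = 0. *)

(** * Calculus of pullbacks along the projection (x, p) |-> x *)

Lemma usubmx_continuous (R : realType) (m n k : nat) :
  continuous (@usubmx R m n k).
Proof.
(* Matrix balls are entrywise and the entries of [usubmx w] are entries of [w], so the same radius
   [e] serves. *)
move=> z s /= /nbhs_ballP[e e0 es]; apply/nbhs_ballP; exists e => //= w [_ zw].
by apply: es; split=> // i j; rewrite !mxE; exact: zw.
Qed.

(** By linearity of [L], the two difference quotients are the same function of the step [h], so
    derivability transfers in both directions. *)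
Lemma derivable_comp_linear (R : numFieldType) (U V W : normedModType R)
    (L : {linear U -> V}) (g : V -> W) (z v : U) :
  derivable (g \o L) z v <-> derivable g (L z) (L v).
Proof.
rewrite /derivable; set a := fun h => _; set b := fun h => _.
suff -> : a = b by [].
by apply/funext => h; rewrite /a /b /= (linearP L).
Qed.

Lemma derive_comp_linear (R : numFieldType) (U V W : normedModType R)
    (L : {linear U -> V}) (g : V -> W) (z v : U) :
  'D_v (g \o L) z = 'D_(L v) g (L z).
Proof.
rewrite /derive; set a := fun h => _; set b := fun h => _.
suff -> : a = b by [].
by apply/funext => h; rewrite /a /b /= (linearP L).
Qed.

Lemma usubmx_delta_lshift (R : nzRingType) (m n : nat) (i : 'I_m) :
  usubmx (delta_mx (lshift n i) 0 : 'cV[R]_(m + n)) = delta_mx i 0.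
Proof. by rewrite delta_mx_ushift col_mxKu. Qed.

Lemma usubmx_delta_rshift (R : nzRingType) (m n : nat) (i : 'I_n) :
  usubmx (delta_mx (rshift m i) 0 : 'cV[R]_(m + n)) = 0.
Proof. by rewrite delta_mx_dshift col_mxKu. Qed.

Lemma dsubmx_delta_lshift (R : nzRingType) (m n : nat) (i : 'I_m) :
  dsubmx (delta_mx (lshift n i) 0 : 'cV[R]_(m + n)) = 0.
Proof. by rewrite delta_mx_ushift col_mxKd. Qed.

Lemma dsubmx_delta_rshift (R : nzRingType) (m n : nat) (i : 'I_n) :
  dsubmx (delta_mx (rshift m i) 0 : 'cV[R]_(m + n)) = delta_mx i 0.
Proof. by rewrite delta_mx_dshift col_mxKd. Qed.

(** An equality of functions rather than of values at a point, so that it rewrites inside [Ck_on]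
    during the induction on the order. *)
Lemma partial_usubmx_lshift (R : realType) (m n : nat) (g : 'cV[R]_m -> R)
    (i : 'I_m) :
  partial (lshift n i) (fun z => g (usubmx z)) = fun z => partial i g (usubmx z).
Proof.
apply/funext => z.
by rewrite /partial (derive_comp_linear (@usubmx R m n 1) g) /= usubmx_delta_lshift.
Qed.

Lemma partial_usubmx_rshift (R : realType) (m n : nat) (g : 'cV[R]_m -> R)
    (i : 'I_n) :
  partial (rshift m i) (fun z => g (usubmx z)) = cst 0.
Proof.
apply/funext => z.
by rewrite /partial (derive_comp_linear (@usubmx R m n 1) g) /= usubmx_delta_rshift derive0.
Qed.

Lemma Ck_on_cst (R : realType) (N k : nat) (D : set 'cV[R]_N) (a : R) :
  Ck_on k D (cst a).
Proof.
(* [a] is generalized because the partials are the constant 0, not [a]. *)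
elim: k a => [|k IHk] a; (split; first by move=> z _; exact: cst_continuous) => //.
move=> i; split=> [z _|]; first exact: derivable_cst.
suff -> : partial i (cst a) = cst 0 by [].
by apply/funext => z; exact: derive_cst.
Qed.

(** Each partial of the pullback is the pullback of a partial of [g] or the constant 0; hence an
    induction on [k] for all [g]. *)
Lemma Ck_on_usubmx (R : realType) (m n k : nat) (D : set 'cV[R]_m)
    (g : 'cV[R]_m -> R) :
  Ck_on k D g ->
  Ck_on k [set z : 'cV[R]_(m + n) | D (usubmx z)] (fun z => g (usubmx z)).
Proof.
have cont h : (forall x, D x -> {for x, continuous h}) ->
    forall z : 'cV[R]_(m + n), D (usubmx z) ->
    {for z, continuous (fun z => h (usubmx z) : R)}.
  move=> hc z Dz; apply: continuous_comp; first exact: usubmx_continuous.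
  exact: hc.
elim: k g => [|k IHk] g [gc gd]; (split; first exact: cont) => // i.
case: (split_ordP i) => j ->; (split; first move=> z Dz).
- apply/(derivable_comp_linear (@usubmx R m n 1) g) => /=.
  by rewrite usubmx_delta_lshift; apply: (gd j).1.
- by rewrite partial_usubmx_lshift; apply: IHk; exact: (gd j).2.
- apply/(derivable_comp_linear (@usubmx R m n 1) g) => /=.
  by rewrite usubmx_delta_rshift; exact: derivable0.
- by rewrite partial_usubmx_rshift; exact: Ck_on_cst.
Qed.

Lemma complex_gradient_usubmx (R : realType) (m n : nat)
    (psi : 'cV[R]_m -> R[i]) (z : 'cV[R]_(m + n)) :
  complex_gradient (fun z : 'cV[R]_(m + n) => psi (usubmx z)) z =
  row_mx (complex_gradient psi (usubmx z)) 0.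
Proof.
apply/rowP => i; case: (split_ordP i) => j ->;
  rewrite ?(row_mxEl, row_mxEr) !mxE.
  by rewrite (partial_usubmx_lshift _ (fun y => complex.Re (psi y)))
    (partial_usubmx_lshift _ (fun y => complex.Im (psi y))).
by rewrite (partial_usubmx_rshift (fun y => complex.Re (psi y)))
  (partial_usubmx_rshift (fun y => complex.Im (psi y))).
Qed.


(** * Transfer of principal eigenfunctions along a semiconjugacy *)

Section Semiconjugacy.
Variables (R : realType) (n p : nat) (f : 'cV[R]_n -> 'cV[R]_n).
Variable F : 'cV[R]_(n + p) -> 'cV[R]_(n + p).
Hypothesis usubmxF : forall z, usubmx (F z) = f (usubmx z).

(** The gradient of the pullback vanishes in the last [p] coordinates, so it meets only the upper
    block of [F], which is [f]. *)
Lemma koopman_usubmx (psi : 'cV[R]_n -> R[i]) (z : 'cV[R]_(n + p)) :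
  koopman F (fun z => psi (usubmx z)) z = koopman f psi (usubmx z).
Proof.
rewrite /koopman complex_gradient_usubmx -[F z]vsubmxK usubmxF.
by rewrite /complex_mx map_col_mx mul_row_col mul0mx addr0.
Qed.

Lemma jacobian_usubmx (z : 'cV[R]_(n + p)) :
  usubmx (jacobian_mx F z) = row_mx (jacobian_mx f (usubmx z)) 0.
Proof.
apply/matrixP => i j.
have Fi : (fun y => F y (lshift p i) 0) = (fun y => f (usubmx y) i 0).
  by apply/funext => y; rewrite -usubmxF mxE.
rewrite 2!mxE Fi; case: (split_ordP j) => k ->.
  by rewrite row_mxEl (partial_usubmx_lshift _ (fun x => f x i 0)) mxE.
by rewrite row_mxEr (partial_usubmx_rshift (fun x => f x i 0)) mxE.
Qed.

(** [eigenvalue] refers to row eigenvectors: padding [v] with zeros annihilates the lower rows of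
    the Jacobian, which are arbitrary here. *)
Lemma eigenvalue_jacobian_usubmx (z : 'cV[R]_(n + p)) (l : R[i]) :
  eigenvalue (complex_mx (jacobian_mx f (usubmx z))) l ->
  eigenvalue (complex_mx (jacobian_mx F z)) l.
Proof.
move=> /eigenvalueP[v vA v0]; apply/eigenvalueP; exists (row_mx v 0).
  rewrite -[jacobian_mx F z]vsubmxK jacobian_usubmx /complex_mx map_col_mx.
  rewrite map_row_mx mul_row_col mul0mx addr0 mul_mx_row vA.
  by rewrite map_mx0 mulmx0 scale_row_mx scaler0.
by apply: contraNneq v0 => /(congr1 lsubmx); rewrite row_mxKl => ->;
  rewrite linear0.
Qed.

Lemma principal_gen_eigenfunctions_usubmx (D : set 'cV[R]_n) (l : R[i])
    (m : nat) (psi : 'I_m -> 'cV[R]_n -> R[i]) :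
  principal_gen_eigenfunctions f D l psi ->
  principal_gen_eigenfunctions F [set z | D (usubmx z)] l
    (fun k z => psi k (usubmx z)).
Proof.
move=> [l_eig [psi1 psi_first psi_next]]; split.
  (* Taken at the equilibrium [z = 0], which projects to the origin. *)
  by apply: eigenvalue_jacobian_usubmx; rewrite linear0.
split=> [k|k k0 z Dz|k k' k'E z Dz].
- split; first exact: (Ck_on_usubmx p (psi1 k).1).
  exact: (Ck_on_usubmx p (psi1 k).2).
- by rewrite koopman_usubmx psi_first.
- by rewrite koopman_usubmx (psi_next k).
Qed.

End Semiconjugacy.

(** * Derivatives and regularity of [H0] *)

Lemma is_derive_dsubmx (R : realType) (m n : nat) (i : 'I_n)
    (z v : 'cV[R]_(m + n)) :
  is_derive z v (fun w => dsubmx w i 0 : R) (dsubmx v i 0).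
Proof.
have -> : (fun w : 'cV[R]_(m + n) => dsubmx w i 0) = fun w => w (rshift m i) 0.
  by apply/funext => w; rewrite mxE.
(* A coordinate is differentiated as an entry of the identity map, whose derivative along [v] is
   [v]. *)
have did : derivable (id : 'cV[R]_(m + n) -> 'cV[R]_(m + n)) z v.
  exact: derivable_id.
apply: DeriveDef.
  by move/derivable_mxP: did => /(_ (rshift m i) 0) h; exact h.
have := derive_mx did.
by rewrite derive_id => /matrixP/(_ (rshift m i) 0); rewrite !mxE.
Qed.

(** Product rule term by term. Derivability of [f] is asked along [usubmx v] only; for a momentum
    direction this is 0 and [derivable0] applies. *)
Lemma is_derive_H0 (R : realType) (n : nat) (f : 'cV[R]_n -> 'cV[R]_n)
    (z v : 'cV[R]_(n + n)) :
  (forall i, derivable (fun x => f x i 0 : R) (usubmx z) (usubmx v)) ->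
  is_derive z v (H0 f)
    (\sum_i (dsubmx z i 0 * 'D_(usubmx v) (fun x => f x i 0 : R) (usubmx z)
             + f (usubmx z) i 0 * dsubmx v i 0)).
Proof.
move=> df.
have -> : H0 f = \sum_i ((fun w => dsubmx w i 0) *
                         ((fun x => f x i 0) \o @usubmx R n n 1)).
  apply/funext => w; rewrite fct_sumE /H0 mxE.
  by apply: eq_bigr => i _; rewrite mxE.
apply: is_derive_sum => i; apply: is_deriveM; first exact: is_derive_dsubmx.
apply: DeriveDef; first exact/derivable_comp_linear.
exact: derive_comp_linear.
Qed.

Lemma derivable_H0 (R : realType) (n : nat) (f : 'cV[R]_n -> 'cV[R]_n)
    (f_smooth : smooth f) (z : 'cV[R]_(n + n)) (i : 'I_(n + n)) :
  derivable (H0 f) z (delta_mx i 0).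
Proof.
apply: ex_derive; apply: is_derive_H0 => j.
case: (split_ordP i) => k ->.
  by rewrite usubmx_delta_lshift; apply: ((f_smooth 1 j).2 k).1.
by rewrite usubmx_delta_rshift; exact: derivable0.
Qed.

Lemma partial_H0_lshift (R : realType) (n : nat) (f : 'cV[R]_n -> 'cV[R]_n)
    (f_smooth : smooth f) (z : 'cV[R]_(n + n)) (i : 'I_n) :
  partial (lshift n i) (H0 f) z =
  \sum_j dsubmx z j 0 * partial i (fun x => f x j 0) (usubmx z).
Proof.
rewrite /partial (@derive_val _ _ _ _ _ _ _ (is_derive_H0 _)); last first.
  by move=> j; rewrite usubmx_delta_lshift; apply: ((f_smooth 1 j).2 i).1.
apply: eq_bigr => j _.
by rewrite usubmx_delta_lshift dsubmx_delta_lshift [X in _ + _ * X]mxE mulr0 addr0.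
Qed.

Lemma partial_H0_rshift (R : realType) (n : nat) (f : 'cV[R]_n -> 'cV[R]_n)
    (z : 'cV[R]_(n + n)) (i : 'I_n) :
  partial (rshift n i) (H0 f) z = f (usubmx z) i 0.
Proof.
rewrite /partial (@derive_val _ _ _ _ _ _ _ (is_derive_H0 _)); last first.
  by move=> j; rewrite usubmx_delta_rshift; exact: derivable0.
(* Along a momentum direction the derivative of [f] is taken in direction 0, and the other factor is
   a Kronecker delta selecting [j = i]. *)
have D0 j : 'D_0 (fun x => f x j 0 : R) (usubmx z) = 0 :> R by exact: derive0.
under eq_bigr => j _ do rewrite usubmx_delta_rshift dsubmx_delta_rshift D0 mulr0
  add0r [X in _ * X]mxE andbT.
by rewrite (bigD1 i)//= eqxx mulr1 big1 ?addr0// => j /negPf ->; rewrite mulr0.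
Qed.

Lemma hamiltonian_field_H0 (R : realType) (n : nat)
    (f : 'cV[R]_n -> 'cV[R]_n) (f_smooth : smooth f) (z : 'cV[R]_(n + n)) :
  hamiltonian_field (H0 f) z =
  col_mx (f (usubmx z)) (- ((jacobian_mx f (usubmx z))^T *m dsubmx z)).
Proof.
rewrite /hamiltonian_field; congr (col_mx _ (- _)); apply/colP => i.
  by rewrite mxE partial_H0_rshift.
rewrite !mxE partial_H0_lshift//; apply: eq_bigr => j _.
by rewrite !mxE mulrC.
Qed.

(** The common shape of [H0], with [g i] the components of [f], and of its x-partials, with [g i]
    their partial derivatives. *)
Lemma continuous_dsubmx_dot (R : realType) (n : nat)
    (g : 'I_n -> 'cV[R]_n -> R) :
  (forall i, continuous (g i)) ->
  continuous (fun z : 'cV[R]_(n + n) =>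
    \sum_i dsubmx z i 0 * g i (usubmx z) : R).
Proof.
move=> gc; rewrite [X in continuous X](_ : _ =
    \sum_i ((fun z : 'cV[R]_(n + n) => dsubmx z i 0 * g i (usubmx z)) : _ -> R)).
  elim/big_ind : _ => [|u v uc vc|i _] z.
  - exact: cst_continuous.
  - exact: continuousD (uc z) (vc z).
  - have dc : {for z, continuous (fun w : 'cV[R]_(n + n) => dsubmx w i 0 : R)}.
      have -> : (fun w : 'cV[R]_(n + n) => dsubmx w i 0 : R) =
                (fun w => w (rshift n i) 0) by apply/funext => w; rewrite mxE.
      exact: coord_continuous.
    apply: continuousM dc _.
    by apply: continuous_comp; [exact: usubmx_continuous|exact: gc].
by apply/funext => z; rewrite fct_sumE.
Qed.

Lemma C1_H0 (R : realType) (n : nat)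
    (f : 'cV[R]_n -> 'cV[R]_n) (f_smooth : smooth f) :
  Ck_on 1 setT (H0 f).
Proof.
split=> [z _|i]; last (split=> [z _|]; [exact: derivable_H0|split=> // z _]).
  have -> : H0 f = fun z => \sum_i dsubmx z i 0 * f (usubmx z) i 0.
    by apply/funext => w; rewrite /H0 mxE; apply: eq_bigr => i _; rewrite mxE.
  apply: (continuous_dsubmx_dot (g := fun i x => f x i 0)) => i x.
  exact: (f_smooth 0 i).1.
case: (split_ordP i) => j ->.
  rewrite (funext (fun z => partial_H0_lshift f_smooth z j)).
  apply: (continuous_dsubmx_dot (g := fun i => partial j (fun x => f x i 0))).
  by move=> k x; apply: ((f_smooth 1 k).2 j).2.1.
rewrite (funext (fun z => partial_H0_rshift f z j)).
apply: (continuous_comp (f := @usubmx R n n 1) (g := fun x => f x j 0 : R)).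
  exact: usubmx_continuous.
exact: (f_smooth 0 j).1.
Qed.

(** * Conservation of the Hamiltonian, and the conclusion *)

Lemma koopman_hamiltonian (R : realType) (n : nat) (H : 'cV[R]_(n + n) -> R)
    (z : 'cV[R]_(n + n)) :
  koopman (hamiltonian_field H) (fun z => (H z)%:C) z = 0.
Proof.
(* The imaginary part is the constant 0, so the complex gradient is real. *)
have dH i : partial i (fun y => complex.Re (H y)%:C) z +i*
            partial i (fun y => complex.Im (H y)%:C) z = (partial i H z)%:C.
  by congr (_ +i* _); exact: derive_cst.
(* The x and p halves of the sum are merged into one sum over ['I_n], whose [i]-th term is the
   [i]-th term of the bracket and cancels by commutativity. *)
rewrite /koopman mxE big_split_ord/= -big_split big1// => i _ /=.
rewrite ![complex_gradient _ _ _ _]mxE !dH ![complex_mx _ _ _]mxE.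
by rewrite col_mxEu col_mxEd !mxE -!rmorphM -rmorphD/= mulrN mulrC subrr.
Qed.

Theorem proposition2 (R : realType) (n : nat)
    (f : 'cV[R]_n -> 'cV[R]_n)
    (f_smooth : smooth f)
    (f0 : f 0 = 0)
    (A_hyperbolic : hyperbolic (jacobian_mx f 0))
    (Px : set 'cV[R]_n)
    (Px_open : open Px) (Px_connected : connected Px) (Px0 : Px 0)
    (q : nat) (lam : 'I_q -> R[i]) (m : 'I_q -> nat)
    (lam_listing : eigenvalue_listing (jacobian_mx f 0) lam m)
    (phi : forall j : 'I_q, 'I_(m j) -> 'cV[R]_n -> R[i])
    (phi_C2 : forall (j : 'I_q) (k : 'I_(m j)), Ck_on_complex 2 Px (phi j k))
    (phi_principal : forall j : 'I_q,
        principal_gen_eigenfunctions f Px (lam j) (phi j)) :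
  [/\ forall z : 'cV[R]_(n + n),
        hamiltonian_field (H0 f) z =
          col_mx (f (usubmx z)) (- ((jacobian_mx f (usubmx z))^T *m dsubmx z)),
      forall j : 'I_q,
        principal_gen_eigenfunctions (hamiltonian_field (H0 f))
          [set z | Px (usubmx z)] (lam j)
          (fun (k : 'I_(m j)) (z : 'cV[R]_(n + n)) => phi j k (usubmx z))
    & eigenfunction (hamiltonian_field (H0 f)) setT 0
        (fun z : 'cV[R]_(n + n) => (H0 f z)%:C)].
Proof.
have HE := hamiltonian_field_H0 f_smooth.
split=> //.
  (* The upper block of the explicit field [HE] supplies the semiconjugacy. *)
  move=> j; apply: principal_gen_eigenfunctions_usubmx (phi_principal j) => z.
  by rewrite HE col_mxKu.
split; first by split; [exact: C1_H0|exact: Ck_on_cst].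
by move=> z _; rewrite mul0r koopman_hamiltonian.
Qed.
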